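(* The group $(G_2)^{\gamma_3}\cap(G_2)^{w_3}$ is isomorphic to $(U(1)\times U(1))/\mathbb{Z}_2$, where $\mathbb{Z}_2=\{(1,1),(-1,-1)\}$.
   Context: Let $\mathbf{H}$ be the quaternions with units $e_1,e_2,e_3=e_1e_2$, and $\mathbf{C}=\{x+ye_1: x,y\in\mathbb{R}\}\subset\mathbf{H}$. Let $\mathfrak{C}=\mathbf{H}\oplus\mathbf{H}e_4$ be the division Cayley algebra with multiplication $(m+ne_4)(p+qe_4)=(mp-\bar q n)+(n\bar p+qm)e_4$ and conjugation $\overline{m+ne_4}=\bar m-ne_4$. Put $G_2=\{\alpha\in\mathrm{Iso}_{\mathbb{R}}(\mathfrak{C}) : \alpha(xy)=(\alpha x)(\alpha y)\}$, where $\mathrm{Iso}_{\mathbb{R}}$ denotes $\mathbb{R}$-linear isomorphisms. Let $\boldsymbol{\omega}=-\tfrac12+\tfrac{\sqrt3}{2}e_1\in\mathbf{C}$. Define $\gamma_3\in G_2$ by $\gamma_3(m+ne_4)=m+(\boldsymbol{\omega}n)e_4$ for $m,n\in\mathbf{H}$. Write $\mathfrak{C}=\mathbf{C}\oplus\mathbf{C}^3$, where $\mathbf{C}^3=\mathbf{C}e_2\oplus\mathbf{C}e_4\oplus\mathbf{C}e_6$ (with $e_6=\pm e_2e_4$; the sign is irrelevant) is the orthogonal complement of $\mathbf{C}$, and define $w_3\in G_2$ by $w_3(m_0+\mathbf{m})=m_0+\boldsymbol{\omega}\mathbf{m}$ for $m_0\in\mathbf{C}$, $\mathbf{m}\in\mathbf{C}^3$.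 For $g\in G_2$, $(G_2)^{g}=\{\alpha\in G_2 : g^{-1}\alpha g=\alpha\}$. $U(1)$ is the group of unit complex numbers. *)

(* Defs.v *)
From HB Require Import structures.
From mathcomp Require Import all_boot all_order all_algebra.
From mathcomp Require Import ring lra.
From mathcomp Require Import boolp reals.
From mathcomp Require Import complex.

Set Implicit Arguments.
Unset Strict Implicit.
Unset Printing Implicit Defensive.

Import Order.TTheory GRing.Theory Num.Theory.
Local Open Scope ring_scope.

(* Quat a b c d stands for a + b e1 + c e2 + d e3, where e3 = e1 e2. *)
Record quaternion (R : Type) := Quat { q0 : R; q1 : R; q2 : R; q3 : R }.

Section Quaternion.
Variable R : realType.
Local Notation H := (quaternion R).
Implicit Types (p q : H) (a : R).

Definition tuple_of_quat p := (q0 p, q1 p, q2 p, q3 p).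
Definition quat_of_tuple (t : R * R * R * R) : H :=
  Quat t.1.1.1 t.1.1.2 t.1.2 t.2.
Lemma tuple_of_quatK : cancel tuple_of_quat quat_of_tuple.
Proof. by case. Qed.

HB.instance Definition _ := Choice.copy H (can_type tuple_of_quatK).

Definition addq p q :=
  Quat (q0 p + q0 q) (q1 p + q1 q) (q2 p + q2 q) (q3 p + q3 q).
Definition oppq p := Quat (- q0 p) (- q1 p) (- q2 p) (- q3 p).
Definition scaleq a p := Quat (a * q0 p) (a * q1 p) (a * q2 p) (a * q3 p).
Definition mulq p q :=
  Quat (q0 p * q0 q - q1 p * q1 q - q2 p * q2 q - q3 p * q3 q)
       (q0 p * q1 q + q1 p * q0 q + q2 p * q3 q - q3 p * q2 q)
       (q0 p * q2 q - q1 p * q3 q + q2 p * q0 q + q3 p * q1 q)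
       (q0 p * q3 q + q1 p * q2 q - q2 p * q1 q + q3 p * q0 q).
Definition conjq p := Quat (q0 p) (- q1 p) (- q2 p) (- q3 p).

Lemma addqA : associative addq.
Proof. by case=> ? ? ? ? [? ? ? ?] [? ? ? ?]; congr Quat => /=; ring. Qed.
Lemma addqC : commutative addq.
Proof. by case=> ? ? ? ? [? ? ? ?]; congr Quat => /=; ring. Qed.
Lemma add0q : left_id (Quat 0 0 0 0) addq.
Proof. by case=> ? ? ? ?; congr Quat => /=; ring. Qed.
Lemma addNq : left_inverse (Quat 0 0 0 0) oppq addq.
Proof. by case=> ? ? ? ?; congr Quat => /=; ring. Qed.
HB.instance Definition _ := GRing.isZmodule.Build H addqA addqC add0q addNq.

Lemma mulqA : associative mulq.
Proof. by case=> ? ? ? ? [? ? ? ?] [? ? ? ?]; congr Quat => /=; ring. Qed.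
Lemma mul1q : left_id (Quat 1 0 0 0) mulq.
Proof. by case=> ? ? ? ?; congr Quat => /=; ring. Qed.
Lemma mulq1 : right_id (Quat 1 0 0 0) mulq.
Proof. by case=> ? ? ? ?; congr Quat => /=; ring. Qed.
Lemma mulqDl : left_distributive mulq addq.
Proof. by case=> ? ? ? ? [? ? ? ?] [? ? ? ?]; congr Quat => /=; ring. Qed.
Lemma mulqDr : right_distributive mulq addq.
Proof. by case=> ? ? ? ? [? ? ? ?] [? ? ? ?]; congr Quat => /=; ring. Qed.
Lemma oneq_neq0 : Quat 1 0 0 0 != 0 :> H.
Proof. by apply/eqP => -[] /eqP; rewrite oner_eq0. Qed.
HB.instance Definition _ :=
  GRing.Zmodule_isNzRing.Build H mulqA mul1q mulq1 mulqDl mulqDr oneq_neq0.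

Lemma scaleqA a b p : scaleq a (scaleq b p) = scaleq (a * b) p.
Proof. by case: p => ? ? ? ?; congr Quat => /=; ring. Qed.
Lemma scale1q : left_id 1 scaleq.
Proof. by case=> ? ? ? ?; congr Quat => /=; ring. Qed.
Lemma scaleqDr : right_distributive scaleq +%R.
Proof. by move=> ? [? ? ? ?] [? ? ? ?]; congr Quat => /=; ring. Qed.
Lemma scaleqDl p : {morph scaleq^~ p : a b / a + b}.
Proof. by case: p => ? ? ? ? ? ?; congr Quat => /=; ring. Qed.
HB.instance Definition _ :=
  GRing.Zmodule_isLmodule.Build R H scaleqA scale1q scaleqDr scaleqDl.

(* The field C = {x + y e1} inside H, as the image of R[i]. *)
Definition quat_of_complex (z : R[i]) : H :=
  Quat (complex.Re z) (complex.Im z) 0 0.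

Definition e2 : H := Quat 0 0 1 0.

Definition omega : R[i] := Complex (- 2^-1) (Num.sqrt 3 / 2).

End Quaternion.

(* The pair (m, n) stands for m + n e4. *)
Definition cayley (R : realType) := (quaternion R * quaternion R)%type.

Section Cayley.
Variable R : realType.
Local Notation H := (quaternion R).
Local Notation Ca := (cayley R).
Implicit Types (x y : Ca).

HB.instance Definition _ :=
  GRing.Lmodule.copy Ca (quaternion R * quaternion R)%type.

(* This is not the componentwise product that pairs inherit from H. *)
Definition cayley_mul x y : Ca :=
  (x.1 * y.1 - conjq y.2 * x.2, x.2 * conjq y.1 + y.2 * x.1).

Definition cayley_of_quat (m : H) : Ca := (m, 0).
Definition cayley_of_complex (z : R[i]) : Ca :=
  cayley_of_quat (quat_of_complex z).
Definition ce2 : Ca := cayley_of_quat (e2 R).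
Definition ce4 : Ca := (0, 1).
Definition ce6 : Ca := cayley_mul ce2 ce4.

Definition gamma3_fun x : Ca := (x.1, quat_of_complex (omega R) * x.2).

(* The orthogonal projection of the Cayley algebra onto C. *)
Definition cayley_Cpart x : Ca := (Quat (q0 x.1) (q1 x.1) 0 0, 0).

(* The C-vector space structure of C^3 = C e2 + C e4 + C e6 is given by left *)
(* multiplication in the Cayley algebra, see w3_funE.                        *)
Definition w3_fun x : Ca :=
  cayley_Cpart x
  + cayley_mul (cayley_of_complex (omega R)) (x - cayley_Cpart x).

Definition cayley_of_C4 (m0 m1 m2 m3 : R[i]) : Ca :=
  cayley_of_complex m0
  + (cayley_mul (cayley_of_complex m1) ce2
     + cayley_mul (cayley_of_complex m2) ce4
     + cayley_mul (cayley_of_complex m3) ce6).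

Lemma w3_funE (m0 m1 m2 m3 : R[i]) :
  w3_fun (cayley_of_C4 m0 m1 m2 m3)
  = cayley_of_C4 m0 (omega R * m1) (omega R * m2) (omega R * m3).
Proof.
case: m0 m1 m2 m3 => [? ?] [? ?] [? ?] [? ?].
by congr pair; congr Quat => /=; field.
Qed.

Lemma cayley_of_C4_surj x :
  x = cayley_of_C4 (Complex (q0 x.1) (q1 x.1)) (Complex (q2 x.1) (q3 x.1))
                   (Complex (q0 x.2) (q1 x.2)) (Complex (q2 x.2) (- q3 x.2)).
Proof.
by case: x => [[? ? ? ?] [? ? ? ?]]; congr pair; congr Quat => /=; ring.
Qed.

End Cayley.

Section G2.
Variable R : realType.
Local Notation Ca := (cayley R).

Definition isG2 : pred (Ca -> Ca) := fun f =>
  `[< [/\ linear f, bijective f &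
          {morph f : x y / cayley_mul x y >-> cayley_mul x y}] >].

Record G2 := MkG2 { G2val :> Ca -> Ca; G2P : isG2 G2val }.

HB.instance Definition _ := [isSub for G2val].
HB.instance Definition _ := [Choice of G2 by <:].

Implicit Types (f g h : G2).

Lemma G2_eq f g : f =1 g -> f = g.
Proof. by move=> fg; apply/val_inj/funext. Qed.

Lemma G2_linear f : linear f. Proof. by case/asboolP: (G2P f). Qed.
Lemma G2_bij f : bijective f. Proof. by case/asboolP: (G2P f). Qed.
Lemma G2_mul f x y : f (cayley_mul x y) = cayley_mul (f x) (f y).
Proof. by case/asboolP: (G2P f) => _ _; apply. Qed.

Lemma isG2_id : isG2 id.
Proof. by apply/asboolP; split=> //; exists id. Qed.
Definition G2_one := MkG2 isG2_id.

Lemma isG2_comp f g : isG2 (f \o g).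
Proof.
apply/asboolP; split.
- by move=> a x y /=; rewrite !G2_linear.
- exact/bij_comp/G2_bij/G2_bij.
- by move=> x y /=; rewrite !G2_mul.
Qed.
Definition G2_comp f g := MkG2 (isG2_comp f g).

Lemma G2_exists_inv f : exists g : G2, cancel f g /\ cancel g f.
Proof.
have [g fK gK] := G2_bij f.
suff Pg : isG2 g by exists (MkG2 Pg).
apply/asboolP; split; last 2 first.
- by exists f.
- by move=> x y; apply: (can_inj fK); rewrite G2_mul !gK.
- by move=> a x y; apply: (can_inj fK); rewrite G2_linear !gK.
Qed.
Definition G2_inv f := projT1 (cid (G2_exists_inv f)).
Lemma G2_invP f : cancel f (G2_inv f) /\ cancel (G2_inv f) f.
Proof. by rewrite /G2_inv; case: cid. Qed.

Lemma G2_compA : associative G2_comp. Proof. by move=> ? ? ?; exact: G2_eq. Qed.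
Lemma G2_comp1l : left_id G2_one G2_comp. Proof. by move=> ?; exact: G2_eq. Qed.
Lemma G2_comp1r : right_id G2_one G2_comp.
Proof. by move=> ?; exact: G2_eq. Qed.
Lemma G2_compV : left_inverse G2_one G2_inv G2_comp.
Proof. by move=> f; apply: G2_eq => x /=; rewrite (G2_invP f).1. Qed.
Lemma G2_compVr : right_inverse G2_one G2_inv G2_comp.
Proof. by move=> f; apply: G2_eq => x /=; rewrite (G2_invP f).2. Qed.
HB.instance Definition _ :=
  isGroup.Build G2 G2_compA G2_comp1l G2_comp1r G2_compV G2_compVr.

Lemma sqr_sqrt3 : Num.sqrt 3 ^+ 2 = 3 :> R.
Proof. by rewrite sqr_sqrtr. Qed.

Lemma isG2_order3 (f : Ca -> Ca) :
    linear f -> (forall x, f (f (f x)) = x) ->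
    {morph f : x y / cayley_mul x y >-> cayley_mul x y} ->
  isG2 f.
Proof.
by move=> lf f3 mf; apply/asboolP; split=> //; exists (fun x => f (f x)).
Qed.

Lemma isG2_gamma3 : isG2 (@gamma3_fun R).
Proof.
have s3 := sqr_sqrt3.
apply: isG2_order3.
- move=> a [[? ? ? ?] [? ? ? ?]] [[? ? ? ?] [? ? ? ?]].
  by congr pair; congr Quat => /=; field.
- move=> [[? ? ? ?] [? ? ? ?]].
  by congr pair; congr Quat => /=; field: s3.
- move=> [[? ? ? ?] [? ? ? ?]] [[? ? ? ?] [? ? ? ?]].
  by congr pair; congr Quat => /=; field: s3.
Qed.
Definition gamma3 := MkG2 isG2_gamma3.

Lemma isG2_w3 : isG2 (@w3_fun R).
Proof.
have s3 := sqr_sqrt3.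
apply: isG2_order3.
- move=> a [[? ? ? ?] [? ? ? ?]] [[? ? ? ?] [? ? ? ?]].
  by congr pair; congr Quat => /=; field.
- move=> [[? ? ? ?] [? ? ? ?]].
  by congr pair; congr Quat => /=; field: s3.
- move=> [[? ? ? ?] [? ? ? ?]] [[? ? ? ?] [? ? ? ?]].
  by congr pair; congr Quat => /=; field: s3.
Qed.
Definition w3 := MkG2 isG2_w3.

End G2.

Section FixedSubgroup.
Local Open Scope group_scope.

Definition fixg (G : groupType) (g : G) : {pred G} :=
  [pred a | g^-1 * a * g == a].

Lemma fixg_group_closed (G : groupType) (g : G) : group_closed (fixg g).
Proof.
split=> [|a b]; rewrite !inE; first by rewrite mulg1 mulVg.
move=> /eqP aE /eqP bE; rewrite -{2}aE -{2}bE.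
by rewrite !invgM invgK !mulgA mulgK.
Qed.

Definition fixgI (G : groupType) (g h : G) : {pred G} :=
  [predI fixg g & fixg h].

Lemma fixgI_group_closed (G : groupType) (g h : G) : group_closed (fixgI g h).
Proof.
have [g1 gF] := fixg_group_closed g; have [h1 hF] := fixg_group_closed h.
split=> [|a b]; first by apply/andP.
by move=> /andP[ag ah] /andP[bg bh]; apply/andP; split; [apply: gF|apply: hF].
Qed.

Definition fixI (G : groupType) (g h : G) := {a : G | a \in fixgI g h}.
HB.instance Definition _ (G : groupType) (g h : G) :=
  SubChoice.on (fixI g h).
HB.instance Definition _ (G : groupType) (g h : G) :=
  SubChoice_isSubGroup.Build G (fixgI g h) (fixI g h) (fixgI_group_closed g h).

End FixedSubgroup.

Section U1.
Variable R : realType.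

Record U1 := MkU1 { U1val :> R[i]; U1P : `|U1val| == 1 }.

HB.instance Definition _ := [isSub for U1val].
HB.instance Definition _ := [Choice of U1 by <:].

Implicit Types (z w : U1).

Lemma U1_norm z : `|U1val z| = 1. Proof. exact/eqP/U1P. Qed.
Lemma U1_neq0 z : U1val z != 0.
Proof. by rewrite -normr_eq0 U1_norm oner_eq0. Qed.

Lemma U1_one_subproof : `|1 : R[i]| == 1. Proof. by rewrite normr1. Qed.
Definition U1_one := MkU1 U1_one_subproof.
Lemma U1_mul_subproof z w : `|U1val z * U1val w| == 1.
Proof. by rewrite normrM !U1_norm mulr1. Qed.
Definition U1_mul z w := MkU1 (U1_mul_subproof z w).
Lemma U1_inv_subproof z : `|(U1val z)^-1| == 1.
Proof. by rewrite normfV U1_norm invr1. Qed.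
Definition U1_inv z := MkU1 (U1_inv_subproof z).
Lemma U1_opp_subproof z : `|- U1val z| == 1.
Proof. by rewrite normrN U1_norm. Qed.
Definition U1_opp z := MkU1 (U1_opp_subproof z).

Lemma U1_mulA : associative U1_mul.
Proof. by move=> ? ? ?; apply/val_inj/mulrA. Qed.
Lemma U1_mulC : commutative U1_mul.
Proof. by move=> ? ?; apply/val_inj/mulrC. Qed.
Lemma U1_mul1 : left_id U1_one U1_mul.
Proof. by move=> ?; apply/val_inj/mul1r. Qed.
Lemma U1_mul1r : right_id U1_one U1_mul.
Proof. by move=> ?; apply/val_inj/mulr1. Qed.
Lemma U1_mulV : left_inverse U1_one U1_inv U1_mul.
Proof. by move=> z; apply/val_inj/mulVf/U1_neq0. Qed.
Lemma U1_mulVr : right_inverse U1_one U1_inv U1_mul.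
Proof. by move=> z; apply/val_inj/mulfV/U1_neq0. Qed.
HB.instance Definition _ :=
  isGroup.Build U1 U1_mulA U1_mul1 U1_mul1r U1_mulV U1_mulVr.

End U1.

Section Quotient.
Variable R : realType.
Local Open Scope group_scope.
Local Open Scope quotient_scope.
Local Notation U := (U1 R * U1 R)%type.
Implicit Types x y z : U.

Definition Z2 : {pred U} :=
  pred2 (1, 1) (U1_opp (1 : U1 R), U1_opp (1 : U1 R)).

Lemma Z2_group_closed : group_closed Z2.
Proof.
have N1 : U1_opp (1 : U1 R) * U1_opp 1 = 1.
  by apply: val_inj; rewrite /= mulrNN mulr1.
split=> [|x y]; first by rewrite !inE eqxx.
have NV : (U1_opp (1 : U1 R))^-1 = U1_opp 1 by apply: mulg1_eq.
have pV (a b : U1 R) : (a, b)^-1 = (a^-1, b^-1) :> U by [].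
have pM (a b c d : U1 R) : (a, b) * (c, d) = (a * c, b * d) :> U by [].
rewrite !inE => /orP[]/eqP -> /orP[]/eqP ->.
all: by rewrite pV pM ?NV ?invg1 ?mulg1 ?mul1g ?N1 eqxx ?orbT.
Qed.

Lemma mulUC x y : x * y = y * x.
Proof. by case: x y => [a b] [c d]; congr pair; exact: U1_mulC. Qed.

Definition Z2_coset x y := x^-1 * y \in Z2.

Lemma Z2_coset_refl : reflexive Z2_coset.
Proof. by move=> x; rewrite /Z2_coset mulVg; exact: Z2_group_closed.1. Qed.
Lemma Z2_coset_sym : symmetric Z2_coset.
Proof.
suff s x y : Z2_coset x y -> Z2_coset y x.
  by move=> x y; apply/idP/idP; exact: s.
move=> /(group_closedV Z2_group_closed).
by rewrite invgM invgK.
Qed.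
Lemma Z2_coset_trans : transitive Z2_coset.
Proof.
move=> y x z xy yz; have := group_closedM Z2_group_closed xy yz.
by rewrite !mulgA mulgK.
Qed.
Canonical Z2_coset_equiv :=
  EquivRel Z2_coset Z2_coset_refl Z2_coset_sym Z2_coset_trans.

Definition U1xU1_mod_Z2 := {eq_quot Z2_coset}.
HB.instance Definition _ := Choice.on U1xU1_mod_Z2.
HB.instance Definition _ := EqQuotient.on U1xU1_mod_Z2.

Definition quo_one : U1xU1_mod_Z2 := \pi_U1xU1_mod_Z2 1.
Definition quo_mul (X Y : U1xU1_mod_Z2) : U1xU1_mod_Z2 :=
  \pi_U1xU1_mod_Z2 (repr X * repr Y).
Definition quo_inv (X : U1xU1_mod_Z2) : U1xU1_mod_Z2 :=
  \pi_U1xU1_mod_Z2 (repr X)^-1.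

Lemma quo_eqP x y :
  reflect (\pi_U1xU1_mod_Z2 x = \pi_U1xU1_mod_Z2 y) (x^-1 * y \in Z2).
Proof.
apply: (iffP idP) => [xy|/eqmodP //].
by apply/eqmodP.
Qed.

Lemma quo_mulE x y :
  quo_mul (\pi_U1xU1_mod_Z2 x) (\pi_U1xU1_mod_Z2 y) = \pi_U1xU1_mod_Z2 (x * y).
Proof.
apply/quo_eqP.
have /quo_eqP xZ : \pi_U1xU1_mod_Z2 (repr (\pi_U1xU1_mod_Z2 x)) =
    \pi_U1xU1_mod_Z2 x.
  exact: reprK.
have /quo_eqP yZ : \pi_U1xU1_mod_Z2 (repr (\pi_U1xU1_mod_Z2 y)) =
    \pi_U1xU1_mod_Z2 y.
  exact: reprK.
move: xZ yZ; set x' := repr (\pi_U1xU1_mod_Z2 x).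
set y' := repr (\pi_U1xU1_mod_Z2 y) => xZ yZ.
have -> : (x' * y')^-1 * (x * y) = (x'^-1 * x) * (y'^-1 * y).
  by rewrite (mulUC x' y') invgM -!mulgA (mulgA y'^-1) (mulUC y'^-1) -mulgA.
exact: (group_closedM Z2_group_closed).
Qed.

Lemma quo_invE x : quo_inv (\pi_U1xU1_mod_Z2 x) = \pi_U1xU1_mod_Z2 x^-1.
Proof.
apply/quo_eqP.
have /quo_eqP xZ : \pi_U1xU1_mod_Z2 x =
    \pi_U1xU1_mod_Z2 (repr (\pi_U1xU1_mod_Z2 x)).
  by symmetry; exact: reprK.
by rewrite invgK mulUC.
Qed.

Lemma quo_surj (X : U1xU1_mod_Z2) : exists x, X = \pi_U1xU1_mod_Z2 x.
Proof. by exists (repr X); rewrite reprK. Qed.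

Lemma quo_mulA : associative quo_mul.
Proof.
move=> X Y Z; have [x ->] := quo_surj X; have [y ->] := quo_surj Y.
by have [z ->] := quo_surj Z; rewrite !quo_mulE mulgA.
Qed.
Lemma quo_mul1 : left_id quo_one quo_mul.
Proof. by move=> X; have [x ->] := quo_surj X; rewrite quo_mulE mul1g. Qed.
Lemma quo_mulr1 : right_id quo_one quo_mul.
Proof. by move=> X; have [x ->] := quo_surj X; rewrite quo_mulE mulg1. Qed.
Lemma quo_mulV : left_inverse quo_one quo_inv quo_mul.
Proof.
by move=> X; have [x ->] := quo_surj X; rewrite quo_invE quo_mulE mulVg.
Qed.
Lemma quo_mulVr : right_inverse quo_one quo_inv quo_mul.
Proof.
by move=> X; have [x ->] := quo_surj X; rewrite quo_invE quo_mulE mulgV.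
Qed.
HB.instance Definition _ :=
  isGroup.Build U1xU1_mod_Z2 quo_mulA quo_mul1 quo_mulr1 quo_mulV quo_mulVr.

End Quotient.

(* Main.v *)
Require Import Defs.
From HB Require Import structures.
From mathcomp Require Import all_boot all_order all_algebra.
From mathcomp Require Import ring lra.
From mathcomp Require Import boolp reals complex.

(* An automorphism commuting with gamma3 and w3 also commutes with the        *)
(* projections onto H (fixed by gamma3) and C (fixed by w3), and, on the      *)
(* complements of these subalgebras, with multiplication by e1.  Hence it     *)
(* fixes e1, sends e2 to u e2 and e4 to z e4 for unit complex numbers u, z,   *)
(* and it is determined by (u, z), which can be arbitrary.  The centralizer   *)
(* is thus already U(1) x U(1); the double cover (p, q) |-> (q^2, p / q) of   *)
(* this torus, whose kernel is Z2, turns it into (U(1) x U(1)) / Z2.  It maps *)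
(* (p, q) to m + n e4 |-> q m q^-1 + (p n q^-1) e4.                           *)

Set Implicit Arguments.
Unset Strict Implicit.
Unset Printing Implicit Defensive.

Import Order.TTheory GRing.Theory Num.Theory.
Local Open Scope ring_scope.

(** The isomorphism inverts the map induced by [cover], which is multiplicative ([coverM]), onto
    ([cover_surj]), and has the cosets of Z2 as its fibres ([cover_eq]). Surjectivity reduces to
    [fix_torus]: by [G2_ext] an automorphism is determined by its values at e1, e2, e4, and
    commutation with [gamma3] and [w3] confines these values to e1, U(1) e2 and U(1) e4. *)

HB.instance Definition _ (R : realType) (f : G2 R) :=
  GRing.isLinear.Build R (cayley R) (cayley R) *:%R f (G2_linear f).

(** * Generation of the Cayley algebra by e1, e2, e4 *)

Section Generators.
Variable R : realType.
Local Notation Ca := (cayley R).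
Implicit Types (x : Ca) (f g : G2 R).

Definition ce1 : Ca := (Quat 0 1 0 0, 0).

Lemma cayley_decomp x :
  x = q0 x.1 *: cayley_of_quat 1 + q1 x.1 *: ce1 + q2 x.1 *: ce2 R
      + q3 x.1 *: cayley_mul ce1 (ce2 R)
      + cayley_mul (q0 x.2 *: cayley_of_quat 1 + q1 x.2 *: ce1 + q2 x.2 *: ce2 R
                    + q3 x.2 *: cayley_mul ce1 (ce2 R)) (ce4 R).
Proof.
case: x => [[? ? ? ?] [? ? ? ?]].
by congr pair; congr Quat => /=; ring.
Qed.

Lemma G2_D f : {morph f : x y / x + y}. Proof. exact: linearD. Qed.
Lemma G2_B f : {morph f : x y / x - y}. Proof. exact: linearB. Qed.
Lemma G2_Z f a : {morph f : x / a *: x}. Proof. exact: linearZ. Qed.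
Lemma G2_0 f : f 0 = 0. Proof. exact: linear0. Qed.
Lemma G2_N f : {morph f : x / - x}. Proof. exact: linearN. Qed.

(** By surjectivity 1 = f y for some y, so 1 (f 1) = f (y 1) = f y = 1. *)
Lemma G2_1 f : f (cayley_of_quat 1) = cayley_of_quat 1.
Proof.
have cayley_mulr1 x : cayley_mul x (cayley_of_quat 1) = x.
  by case: x => [[? ? ? ?] [? ? ? ?]]; congr pair; congr Quat => /=; ring.
have cayley_mul1r x : cayley_mul (cayley_of_quat 1) x = x.
  by case: x => [[? ? ? ?] [? ? ? ?]]; congr pair; congr Quat => /=; ring.
by rewrite -[LHS]cayley_mul1r -[X in cayley_mul X _](G2_invP f).2 -G2_mul
  cayley_mulr1 (G2_invP f).2.
Qed.

Lemma G2_ext f g :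
  f ce1 = g ce1 -> f (ce2 R) = g (ce2 R) -> f (ce4 R) = g (ce4 R) -> f = g.
Proof.
move=> fg1 fg2 fg4; apply: G2_eq => x; rewrite (cayley_decomp x).
by rewrite !(G2_D, G2_Z, G2_mul) !G2_1 fg1 fg2 fg4.
Qed.

End Generators.
Arguments ce1 {R}.

(** * The torus of automorphisms attached to pairs (u, z) *)

Section Torus.
Variable R : realType.
Local Notation Ca := (cayley R).
Local Notation U := (U1 R * U1 R)%type.
Implicit Types (u : U1 R) (p : quaternion R) (x : Ca).

(** The monomial left-hand side lets [ring] use the equation as a reduction rule. *)
Lemma normc1P (a b : R) :
  reflect (a ^+ 2 = 1 - b ^+ 2) (`|Complex a b| == 1).
Proof.
rewrite -(@eqrXn2 _ 2 `|_| 1) // -add_Re2_Im2 expr1n (inj_eq (@complexI R)) /=.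
by rewrite eq_sym -subr_eq eq_sym; apply: eqP.
Qed.

(* Conjugation by a square root of [u] in C. *)
Definition twist u p : quaternion R :=
  let: Complex a b := U1val u in
  Quat (q0 p) (q1 p) (a * q2 p - b * q3 p) (b * q2 p + a * q3 p).

(** The coordinates (u, z) avoid choosing a square root, and they can be read off from the images of
    e2 and e4, which makes [torus] injective. *)
Definition torus_fun (y : U) x : Ca :=
  (twist y.1 x.1, quat_of_complex (U1val y.2) * twist y.1 x.2).

Lemma torus_fun1 x : torus_fun 1%g x = x.
Proof.
by case: x => [[? ? ? ?] [? ? ? ?]]; congr pair; congr Quat => /=; ring.
Qed.

Lemma torus_funM (y y' : U) x :
  torus_fun (y * y')%g x = torus_fun y (torus_fun y' x).
Proof.
case: y y' x => [[[? ?] ?] [[? ?] ?]] [[[? ?] ?] [[? ?] ?]].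
move=> [[? ? ? ?] [? ? ? ?]].
by congr pair; congr Quat => /=; ring.
Qed.

Lemma isG2_torus (y : U) : isG2 (torus_fun y).
Proof.
apply/asboolP; split.
- case: y => [[[? ?] ?] [[? ?] ?]].
  move=> a [[? ? ? ?] [? ? ? ?]] [[? ? ? ?] [? ? ? ?]].
  by congr pair; congr Quat => /=; ring.
- by exists (torus_fun y^-1%g) => x; rewrite -torus_funM ?mulVg ?mulgV torus_fun1.
- case: y => [[[a b] u1] [[c d] v1]].
  have ab := normc1P _ _ u1; have cd := normc1P _ _ v1.
  move=> [[? ? ? ?] [? ? ? ?]] [[? ? ? ?] [? ? ? ?]].
  by congr pair; congr Quat => /=; ring: ab cd.
Qed.

Definition torus (y : U) : G2 R := MkG2 (isG2_torus y).

Lemma torusM (y y' : U) : torus (y * y')%g = (torus y * torus y')%g.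
Proof. by apply: G2_eq => x; exact: torus_funM. Qed.

Lemma torus_ce1 (y : U) : torus y ce1 = ce1.
Proof.
by case: y => [[[a b] ?] [[c d] ?]]; congr pair; congr Quat => /=; ring.
Qed.

Lemma torus_ce2 (y : U) :
  torus y (ce2 R) = (Quat 0 0 (complex.Re (U1val y.1)) (complex.Im (U1val y.1)), 0).
Proof.
by case: y => [[[a b] ?] [[c d] ?]]; congr pair; congr Quat => /=; ring.
Qed.

Lemma torus_ce4 (y : U) : torus y (ce4 R) = (0, quat_of_complex (U1val y.2)).
Proof.
by case: y => [[[a b] ?] [[c d] ?]]; congr pair; congr Quat => /=; ring.
Qed.

Lemma torus_inj : injective torus.
Proof.
move=> y y' ff.
have := congr1 (fun f : G2 R => f (ce2 R)) ff.
have := congr1 (fun f : G2 R => f (ce4 R)) ff.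
rewrite !(torus_ce2, torus_ce4); clear ff.
case: y y' => [[[a b] ?] [[c d] ?]] [[[? ?] ?] [[? ?] ?]] /=.
by move=> [cc dd] [aa bb]; congr pair; apply: val_inj; congr Complex.
Qed.

End Torus.

(** * Automorphisms commuting with [gamma3] and [w3] *)

Section Centralizer.
Variable R : realType.
Local Notation Ca := (cayley R).
Implicit Types (x : Ca) (f g : G2 R).

Lemma fixgP f g : reflect (forall x, f (g x) = g (f x)) (f \in fixg g).
Proof.
rewrite inE -(inj_eq (mulgI g)) !mulgA mulgV mul1g.
apply: (iffP eqP) => [fg x|fg]; last exact: G2_eq.
exact: (congr1 (fun h : G2 R => h x) fg).
Qed.

(** Averaging over a cyclic group of order 3 projects onto its fixed subspace; as a polynomial in
    [gamma3], the projection commutes with whatever commutes with [gamma3]. *)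
Lemma gamma3_proj x :
  (x.1, 0) = 3^-1 *: (x + gamma3 R x + gamma3 R (gamma3 R x)) :> Ca.
Proof.
have s3 := sqr_sqrt3 R; case: x => [[? ? ? ?] [? ? ? ?]].
by congr pair; congr Quat => /=; field: s3.
Qed.

Lemma w3_proj x : cayley_Cpart x = 3^-1 *: (x + w3 R x + w3 R (w3 R x)).
Proof.
have s3 := sqr_sqrt3 R; case: x => [[? ? ? ?] [? ? ? ?]].
by congr pair; congr Quat => /=; field: s3.
Qed.

(* With s = sqrt 3: on the complement of its fixed subspace an order 3 map g *)
(* equals - 1 / 2 + (s / 2) J, so that g - g^2 = s J and 1 / s = s / 3.      *)
Lemma gamma3_rot x :
  (0, Quat 0 1 0 0 * x.2) =
  (Num.sqrt 3 / 3) *: (gamma3 R x - gamma3 R (gamma3 R x)) :> Ca.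
Proof.
have s3 := sqr_sqrt3 R; case: x => [[? ? ? ?] [? ? ? ?]].
by congr pair; congr Quat => /=; field: s3.
Qed.

Lemma w3_rot x :
  cayley_mul ce1 (x - cayley_Cpart x) =
  (Num.sqrt 3 / 3) *: (w3 R x - w3 R (w3 R x)).
Proof.
have s3 := sqr_sqrt3 R; case: x => [[? ? ? ?] [? ? ? ?]].
by congr pair; congr Quat => /=; field: s3.
Qed.

Section Commuting.
Variable f : G2 R.
Hypotheses (fg : f \in fixg (gamma3 R)) (fw : f \in fixg (w3 R)).

Lemma fix_proj x : f (x.1, 0) = ((f x).1, 0).
Proof.
by rewrite !gamma3_proj G2_Z !G2_D !(fixgP _ _ fg).
Qed.

Lemma fix_Cpart x : f (cayley_Cpart x) = cayley_Cpart (f x).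
Proof. by rewrite !w3_proj G2_Z (G2_D f (_ + _)) (G2_D f x) !(fixgP _ _ fw). Qed.

Lemma fix_rot4 x : f (0, Quat 0 1 0 0 * x.2) = (0, Quat 0 1 0 0 * (f x).2).
Proof. by rewrite !gamma3_rot G2_Z G2_B !(fixgP _ _ fg). Qed.

Lemma fix_rot x :
  f (cayley_mul ce1 (x - cayley_Cpart x)) =
  cayley_mul ce1 (f x - cayley_Cpart (f x)).
Proof. by rewrite !w3_rot G2_Z G2_B !(fixgP _ _ fw). Qed.

Lemma fix_ce2 : exists u : U1 R,
  f (ce2 R) = (Quat 0 0 (complex.Re (U1val u)) (complex.Im (U1val u)), 0).
Proof.
have [c [d fE]] : exists c d, f (ce2 R) = (Quat 0 0 c d, 0).
  have := fix_proj (ce2 R); have := fix_Cpart (ce2 R).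
  rewrite -[cayley_Cpart (ce2 R)]/(0 : Ca) G2_0 -[((ce2 R).1, 0)]/(ce2 R).
  case: (f (ce2 R)) => [[p0 p1 c d] n] /esym[-> ->] [->].
  by exists c, d.
have cd : `|Complex c d| == 1.
  have sqE : cayley_mul (ce2 R) (ce2 R) = - cayley_of_quat 1.
    by congr pair; congr Quat => /=; ring.
  have := congr1 f sqE; rewrite G2_mul G2_N G2_1 fE => -[+ _ _ _ _ _ _ _].
  by move=> cd; apply/normc1P; lra.
by exists (MkU1 cd).
Qed.

(** On H e4 the complex structure of [gamma3] is n |-> e1 n and that of [w3] is n |-> n e1. They
    agree at e4, hence at its image n e4, so n commutes with e1 and lies in C. Squaring gives the
    norm. *)
Lemma fix_ce4 : exists z : U1 R, f (ce4 R) = (0, quat_of_complex (U1val z)).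
Proof.
have [a [b fE]] : exists a b, f (ce4 R) = (0, Quat a b 0 0).
  have rotE : cayley_mul ce1 (ce4 R - cayley_Cpart (ce4 R)) =
      (0, Quat 0 1 0 0 * (ce4 R).2).
    by congr pair; congr Quat => /=; ring.
  have := fix_rot (ce4 R); rewrite rotE fix_rot4.
  have := fix_proj (ce4 R); rewrite -[((ce4 R).1, 0)]/(0 : Ca) G2_0.
  case: (f (ce4 R)) => [p [a b c d]] /= /esym[->] [_ _ cN dN].
  by exists a, b; congr pair; congr Quat; lra.
have ab : `|Complex a b| == 1.
  have sqE : cayley_mul (ce4 R) (ce4 R) = - cayley_of_quat 1.
    by congr pair; congr Quat => /=; ring.
  have := congr1 f sqE; rewrite G2_mul G2_N G2_1 fE => -[+ _ _ _ _ _ _ _].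
  by move=> ab; apply/normc1P; lra.
by exists (MkU1 ab).
Qed.

(** Computing f (e1 e2) both ways gives (f e1) (f e2) = e1 (f e2), where f e1 lies in C; the unit f
    e2 can then be cancelled. *)
Lemma fix_ce1 : f ce1 = ce1.
Proof.
have [[[c d] cdP] /= fE2] := fix_ce2; have cd := normc1P _ _ cdP.
have := fix_rot (ce2 R); have := fix_Cpart ce1.
rewrite G2_mul G2_B -[cayley_Cpart (ce2 R)]/(0 : Ca) G2_0 subr0 fE2.
rewrite -[cayley_Cpart ce1]/ce1.
case: (f ce1) => [[a b p2 p3] n] /= [-> -> ->] [_ _ e2 e3 _ _ _ _].
have {}e2 : a * c - b * d = - d by move: e2; lra.
have {}e3 : a * d + b * c = c by move: e3; lra.
congr pair; congr Quat.
(* Multiplication by the conjugate of c + d i, of norm 1, solves the linear system for a + b i. *)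
- have -> : a = c * (a * c - b * d) + d * (a * d + b * c)
      - a * (c ^+ 2 + d ^+ 2 - 1) by ring.
  by rewrite e2 e3; ring: cd.
- have -> : b = c * (a * d + b * c) - d * (a * c - b * d)
      - b * (c ^+ 2 + d ^+ 2 - 1) by ring.
  by rewrite e2 e3; ring: cd.
Qed.

Lemma fix_torus : exists y, f = torus y.
Proof.
have [u fE2] := fix_ce2; have [z fE4] := fix_ce4; exists (u, z).
by apply: G2_ext; rewrite ?torus_ce1 ?torus_ce2 ?torus_ce4 // fix_ce1.
Qed.

End Commuting.

Lemma torus_fix (y : U1 R * U1 R) : torus y \in fixgI (gamma3 R) (w3 R).
Proof.
apply/andP; split; apply/fixgP => x.
- case: y x => [[[a b] ?] [[c d] ?]] [[? ? ? ?] [? ? ? ?]].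
  by congr pair; congr Quat => /=; ring.
- case: y x => [[[a b] ?] [[c d] ?]] [[? ? ? ?] [? ? ? ?]].
  by congr pair; congr Quat => /=; ring.
Qed.

End Centralizer.

(** * The double cover of the torus and its kernel *)

Section Cover.
Variable R : realType.
Local Notation U := (U1 R * U1 R)%type.
Local Open Scope group_scope.

Lemma U1_sqrt (u : U1 R) : exists q : U1 R, q * q = u.
Proof.
have qP : (`|sqrtC (U1val u)| == 1)%R.
  by rewrite -(@eqrXn2 _ 2 `|_|%R 1%R) // -normrX sqrtCK expr1n U1_norm.
by exists (MkU1 qP); apply: val_inj; rewrite /= -expr2 sqrtCK.
Qed.

Lemma U1_sqr_eq1 (u : U1 R) : u * u = 1 -> u = 1 \/ u = U1_opp 1.
Proof.
move=> /(congr1 (@U1val R)) /= /eqP; rewrite -expr2 sqrf_eq1 => /orP[]/eqP uE.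
- by left; apply: val_inj.
- by right; apply: val_inj.
Qed.

Definition cover (x : U) : fixI (gamma3 R) (w3 R) :=
  Sub (torus (x.2 * x.2, x.1 * x.2^-1)) (torus_fix _).

Lemma coverM (x y : U) : cover (x * y) = cover x * cover y.
Proof.
have U1C (u v : U1 R) : u * v = v * u by exact: U1_mulC.
apply: val_inj; rewrite /= -torusM; congr torus; congr pair => /=.
- by rewrite -!mulgA; congr (_ * _); rewrite !mulgA (U1C y.2).
- by rewrite invgM -!mulgA; congr (_ * _); rewrite mulgA U1C.
Qed.

Lemma cover_surj (f : fixI (gamma3 R) (w3 R)) : exists x, f = cover x.
Proof.
case: f => f fP; have /andP[fg fw] := fP.
have [[u z] fE] := fix_torus fg fw; have [q qq] := U1_sqrt u.
exists (z * q, q); apply: val_inj => /=.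
by rewrite fE qq mulgK.
Qed.

Lemma cover_eq (x y : U) : cover x = cover y <-> x^-1 * y \in @Z2 R.
Proof.
have cover1 : val (cover 1) = torus (1, 1).
  by congr torus; congr pair; apply: val_inj; rewrite /= ?invr1 mulr1.
have cover_eq1 (w : U) : cover w = cover 1 <-> w \in @Z2 R.
  split=> [/(congr1 val)|].
    rewrite cover1; case: w => p q /torus_inj pqE.
    (* The kernel is given by q^2 = 1 and p / q = 1, that is p = q = 1 or p = q = -1. *)
    have /= /U1_sqr_eq1 q1 := congr1 fst pqE.
    have /= /divg1_eq -> := congr1 snd pqE.
    by case: q1 => ->; rewrite !inE eqxx ?orbT.
  rewrite !inE => /orP[]/eqP-> //.
  apply: val_inj; rewrite cover1; congr torus; rewrite /= mulgV.
  by congr pair; apply: val_inj; rewrite /= mulrNN mulr1.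
rewrite -cover_eq1; split=> [xy|].
- by apply: (mulgI (cover x)); rewrite -!coverM mulg1 mulVKg.
- by move=> /(congr1 (fun g => cover x * g)); rewrite -!coverM mulg1 mulVKg.
Qed.

End Cover.

Theorem theorem4p1p1 (R : realType) :
  exists f : {multiplicative fixI (gamma3 R) (w3 R) -> U1xU1_mod_Z2 R},
    bijective f.
Proof.
pose lift f := projT1 (cid (@cover_surj R f)).
have liftK f : f = cover (lift f) := projT2 (cid (@cover_surj R f)).
(* The class of a chosen preimage under [cover]; by [cover_eq] it does not depend on the choice. *)
pose phi f : U1xU1_mod_Z2 R := (\pi_(U1xU1_mod_Z2 R) (lift f))%qT.
have phi_cover x : phi (cover x) = (\pi_(U1xU1_mod_Z2 R) x)%qT.
  by apply/quo_eqP/cover_eq; rewrite -liftK.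
have phiM : {morph phi : f g / (f * g)%g}.
  move=> f g; rewrite {1}(liftK f) {1}(liftK g) -coverM phi_cover.
  exact/esym/quo_mulE.
pose psi (X : U1xU1_mod_Z2 R) := cover (repr X : U1 R * U1 R).
pose Phi : {multiplicative fixI (gamma3 R) (w3 R) -> U1xU1_mod_Z2 R} :=
  HB.pack phi (isMultiplicative.Build _ _ phi phiM).
exists Phi, psi => [f|X] /=.
- rewrite [RHS]liftK; apply/cover_eq/quo_eqP; exact: reprK.
- by rewrite /psi phi_cover reprK.
Qed.
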